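(* Let $\nabla:=\prod_pp^\infty$ be the largest supernatural number. Then the map $r\mapsto B(r,\nabla)$ is a homeomorphism of the finite integral adeles $\widehat{\mathbb Z}$ onto the boundary $\partial\Omega$ of $(\mathbb Q\rtimes\mathbb Q_+^*,\mathbb N\rtimes\mathbb N^\times)$. Under this homeomorphism, the left action of $(m,a)\in\mathbb N\rtimes\mathbb N^\times$ on $\widehat{\mathbb Z}$ is given, in terms of the ring operations in $\widehat{\mathbb Z}$, by $(m,a)\cdot r=m+ar$; that is, $\theta_{(m,a)}(B(r,\nabla))=B(m+ar,\nabla)$.
   Context: $\mathbb N=\{0,1,2,\dots\}$; $\mathbb N^\times$ is the multiplicative semigroup of positive integers; $P=\mathbb N\rtimes\mathbb N^\times$ has product $(m,a)(n,b)=(m+an,ab)$ and partial order $(m,a)\le(n,b)\iff a^{-1}(n-m)\in\mathbb N$ and $a^{-1}b\in\mathbb N^\times$; it is a submonoid of the group $\mathbb Q\rtimes\mathbb Q_+^*$ (same product formula). The Nica spectrum $\Omega$ is the set of nonempty hereditary (downward closed in $P$) directed subsets of $P$, with the topology inherited from the compact product space $\{0,1\}^P$. The boundary $\partial\Omega$ is the closure in $\Omega$ of the set of maximal (with respect to inclusion) elements of $\Omega$. For $x\in P$, the action on $\Omega$ is $\theta_x(\omega)=\operatorname{Her}(x\omega)$, the hereditary closure $\{y\in P:y\le xz\text{ for some }z\in\omega\}$ of $x\omega=\{xz:z\in\omega\}$. $\widehat{\mathbb Z}=\mathbb Z/\nabla:=\varprojlim_{a\in\mathbb N^\times}\mathbb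 Z/a\mathbb Z$ with its profinite topology; $r(a)\in\mathbb Z/a\mathbb Z$ is the image of $r\in\widehat{\mathbb Z}$, viewed as a residue class of integers. $B(r,\nabla):=\{(m,a)\in\mathbb N\rtimes\mathbb N^\times:m\in r(a)\}$. *)

(* Defs.v *)
From HB Require Import structures.
From mathcomp Require Import all_boot all_order all_algebra.
From mathcomp Require Import all_classical all_reals all_analysis.

Set Implicit Arguments.
Unset Strict Implicit.
Unset Printing Implicit Defensive.

Import Order.TTheory GRing.Theory Num.Theory.

Local Open Scope classical_set_scope.
Local Open Scope ring_scope.

(** * The monoid N x| N^* and its order *)

Definition posnat := {a : nat | (0 < a)%N}.

Definition posnat_val (a : posnat) : nat := \val a.
Coercion posnat_val : posnat >-> nat.

Lemma posnat_gt0 (a : posnat) : (0 < a)%N.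
Proof. exact: (valP a). Qed.

Lemma posnat_inj (a b : posnat) : a = b :> nat -> a = b.
Proof. exact: val_inj. Qed.

Lemma posnat_mul_subproof (a b : posnat) : (0 < a * b)%N.
Proof. by rewrite muln_gt0 !posnat_gt0. Qed.

Definition posnat_mul (a b : posnat) : posnat :=
  exist _ (a * b)%N (posnat_mul_subproof a b).

Definition posnat_one : posnat := exist _ 1%N isT.

Definition affN : Type := (nat * posnat)%type.

Definition affN_mul (x y : affN) : affN :=
  ((x.1 + x.2 * y.1)%N, posnat_mul x.2 y.2).

Definition affN_one : affN := (0%N, posnat_one).

HB.instance Definition _ := Choice.copy affN (nat * posnat)%type.

Fact affN_mulA : associative affN_mul.
Proof.
move=> [m a] [n b] [k c]; congr pair; last by apply: posnat_inj; exact: mulnA.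
by rewrite /= mulnDr addnA mulnA.
Qed.

Fact affN_mul1x : left_id affN_one affN_mul.
Proof.
move=> [m a]; congr pair; last by apply: posnat_inj; exact: mul1n.
by rewrite /= mul1n.
Qed.

Fact affN_mulx1 : right_id affN_one affN_mul.
Proof.
move=> [m a]; congr pair; last by apply: posnat_inj; exact: muln1.
by rewrite /= muln0 addn0.
Qed.

HB.instance Definition _ :=
  isMonoid.Build affN affN_mulA affN_mul1x affN_mulx1.

(* x <= y iff x^-1 y, computed in Q x| Q_+^*, lies in the submonoid N x| N^*;
   see [affN_leP]. *)
Definition affN_le (x y : affN) : bool :=
  let: (m, a) := x in let: (n, b) := y in
  ((a%:R : rat)^-1 * (n%:R - m%:R) \is a Num.nat) &&
  ((0 < (a%:R : rat)^-1 * b%:R) && ((a%:R : rat)^-1 * b%:R \is a Num.nat)).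

Lemma affN_leP (x y : affN) :
  reflect (exists z : affN, y = (x * z)%g) (affN_le x y).
Proof.
have a0 (a : posnat) : (a%:R : rat) != 0.
  by rewrite pnatr_eq0 -lt0n posnat_gt0.
case: x y => [m a] [n b]; apply: (iffP and3P).
  case=> /natrP[k kE] lt0 /natrP[c cE].
  have {}kE : n = (m + a * k)%N.
    apply/eqP; rewrite -(eqr_nat rat) natrD natrM -kE mulrA divff// mul1r.
    by rewrite addrC subrK.
  have c0 : (0 < c)%N by move: lt0; rewrite cE ltr0n.
  exists (k, exist _ c c0); congr pair => //.
  apply: posnat_inj; apply/eqP; rewrite -(eqr_nat rat) natrM -cE mulrA divff//.
  by rewrite mul1r.
move=> [[k c] [-> ->]]; rewrite natrD natrM [X in X - _]addrC addrK.
rewrite /= natrM !mulrA mulVf// !mul1r !natr_nat; split=> //.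
by rewrite ltr0n posnat_gt0.
Qed.

Fact affN_le_refl : reflexive affN_le.
Proof. by move=> x; apply/affN_leP; exists 1%g; rewrite mulg1. Qed.

Fact affN_le_trans : transitive affN_le.
Proof.
move=> y x z /affN_leP[u ->] /affN_leP[v ->]; apply/affN_leP.
by exists (u * v)%g; rewrite mulgA.
Qed.

Fact affN_le_anti : antisymmetric affN_le.
Proof.
move=> [m a] [n b] /andP[/affN_leP[[k c] [-> ->]] /affN_leP[[k' c'] [E F]]].
have a0 := posnat_gt0 a.
have k0 : k = 0%N.
  apply/eqP; move/eqP: E; rewrite -addnA -[X in X == _]addn0 eqn_add2l eq_sym.
  by rewrite addn_eq0 muln_eq0 -[posnat_val a == _]leqn0 leqNgt a0 => /andP[].
have {}F : (a * 1 = a * (c * c'))%N.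
  by rewrite muln1 mulnA; exact: (congr1 posnat_val F).
have c1 : c = 1%N :> nat.
  by apply/eqP; move/eqP: F; rewrite eqn_pmul2l// eq_sym muln_eq1 => /andP[].
congr pair; first by rewrite k0 muln0 addn0.
by apply: posnat_inj; rewrite -[posnat_val a]muln1 -[in LHS]c1.
Qed.

Fact affN_display : Order.disp_t. Proof. exact: Order.Disp tt tt. Qed.

HB.instance Definition _ := Order.Le_isPOrder.Build affN_display affN
  affN_le_refl affN_le_anti affN_le_trans.

Lemma le_affNP (x y : affN) :
  reflect (exists z : affN, y = (x * z)%g) (x <= y)%O.
Proof. exact: affN_leP. Qed.

(** * The Nica spectrum and its boundary *)

Definition hereditary (A : set affN) :=
  forall x y : affN, (x <= y)%O -> A y -> A x.

Definition directed (A : set affN) :=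
  forall x y : affN, A x -> A y -> exists z, [/\ A z, (x <= z)%O & (y <= z)%O].

(* A subset of [affN] is identified with its indicator function, a point of
   the product space {0,1}^affN. *)
Definition supp (w : {ptws affN -> bool}) : set affN := [set x | w x].

Definition nica_set : set {ptws affN -> bool} :=
  [set w | [/\ supp w !=set0, hereditary (supp w) & directed (supp w)]].

(* The canonical topology on this sigma type is the subspace topology. *)
Definition nica_spectrum : Type := set_type nica_set.

HB.instance Definition _ := Topological.on nica_spectrum.

Definition carrier (w : nica_spectrum) : set affN := supp (\val w).

Lemma carrier_inj : injective carrier.
Proof.
move=> v w vw; apply/val_inj/funext => x.
by apply/idP/idP; have /= := congr1 (@^~ x) vw; rewrite /carrier /supp/= => ->.
Qed.

Section MkNica.
Variables (A : set affN) (A0 : A !=set0) (hA : hereditary A) (dA : directed A).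

Fact mk_nica_subproof :
  ((fun x => `[< A x >]) : {ptws affN -> bool}) \in nica_set.
Proof.
have E : supp (fun x => `[< A x >]) = A.
  by apply/seteqP; split=> x /asboolP.
by apply/mem_set; split; rewrite E.
Qed.

Definition mk_nica : nica_spectrum :=
  exist (fun w => w \in nica_set) _ mk_nica_subproof.

Lemma carrier_mk_nica : carrier mk_nica = A.
Proof. by apply/seteqP; split=> x /asboolP. Qed.

End MkNica.

Definition nica_maximal : set nica_spectrum :=
  [set w | forall v, carrier w `<=` carrier v -> v = w].

Definition nica_boundary : set nica_spectrum := closure nica_maximal.

Definition Her (A : set affN) : set affN :=
  [set y | exists2 z, A z & (y <= z)%O].

Section Theta.
Variables (x : affN) (w : nica_spectrum).

Definition translate : set affN := [set (x * z)%g | z in carrier w].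

Fact theta_nonempty : Her translate !=set0.
Proof.
have /set_mem[[z wz] _ _] := valP w.
by exists (x * z)%g, (x * z)%g => //; exists z.
Qed.

Fact theta_hereditary : hereditary (Her translate).
Proof. by move=> y y' yy' [z ? y'z]; exists z => //; exact: le_trans yy' _. Qed.

Fact theta_directed : directed (Her translate).
Proof.
have mulS (u v : affN) : (u <= v)%O -> ((x * u)%g <= (x * v)%g)%O.
  by move=> /le_affNP[t ->]; apply/le_affNP; exists t; rewrite mulgA.
have /set_mem[_ _ dw] := valP w.
move=> y y' [_ [u wu <-] yu] [_ [v wv <-] y'v].
have [t [wt ut vt]] := dw _ _ wu wv.
exists (x * t)%g; split.
- by exists (x * t)%g => //; exists t.
- exact: le_trans yu (mulS _ _ ut).
- exact: le_trans y'v (mulS _ _ vt).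
Qed.

Definition theta : nica_spectrum :=
  mk_nica theta_nonempty theta_hereditary theta_directed.

Lemma carrier_theta : carrier theta = Her translate.
Proof. exact: carrier_mk_nica. Qed.

End Theta.

(** * The profinite completion of Z *)

(* [Zmod a] is Z/aZ for every a >= 1; unlike ['Z_a] it is trivial for a = 1. *)
Definition Zmod (a : posnat) : Type := 'I_a.

HB.instance Definition _ a := Finite.on (Zmod a).

Definition Zmod_prod := prod_topology (fun a => discrete_topology (Zmod a)).

Definition coherent : set Zmod_prod :=
  [set r | forall a b : posnat, (a %| b)%N ->
     (r a : Zmod a) = (r b : Zmod b) %[mod a]].

(* Again the canonical topology is the subspace topology. *)
Definition Zhat : Type := set_type coherent.

HB.instance Definition _ := Topological.on Zhat.

Definition residue (r : Zhat) (a : posnat) : Zmod a := \val r a.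

Lemma residue_mod (r : Zhat) (a b : posnat) :
  (a %| b)%N -> residue r a = residue r b %[mod a].
Proof. by move: a b; exact: (set_mem (valP r)). Qed.

Lemma Zhat_ext (r s : Zhat) :
  (forall a, residue r a = residue s a :> nat) -> r = s.
Proof.
move=> rs; apply/val_inj/functional_extensionality_dep => a.
exact/val_inj/rs.
Qed.

Section MkZhat.
Variables (f : forall a, Zmod a)
  (fP : forall a b : posnat, (a %| b)%N -> f a = f b %[mod a]).

Fact mk_Zhat_subproof : (f : Zmod_prod) \in coherent.
Proof. exact/mem_set. Qed.

Definition mk_Zhat : Zhat := exist (fun r => r \in coherent) _ mk_Zhat_subproof.

End MkZhat.

Definition Zmod_nat (n : nat) (a : posnat) : Zmod a :=
  Ordinal (ltn_pmod n (posnat_gt0 a)).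

Fact Zhat_nat_subproof n (a b : posnat) :
  (a %| b)%N -> Zmod_nat n a = Zmod_nat n b %[mod a].
Proof. by move=> ab; rewrite /= modn_mod modn_dvdm. Qed.

Definition Zhat_nat n : Zhat := mk_Zhat (@Zhat_nat_subproof n).

Fact Zhat_opp_subproof (r : Zhat) (a b : posnat) : (a %| b)%N ->
  Zp_opp (residue r a) = Zp_opp (residue r b) %[mod a].
Proof.
move=> ab; rewrite /= modn_mod modn_dvdm//.
apply/eqP; rewrite -(eqn_modDr (residue r a)) subnK; last exact: ltnW.
rewrite -modnDmr (residue_mod r ab) modnDmr subnK; last exact: ltnW.
by rewrite modnn eq_sym.
Qed.

Fact Zhat_add_subproof (r s : Zhat) (a b : posnat) : (a %| b)%N ->
  Zp_add (residue r a) (residue s a) =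
  Zp_add (residue r b) (residue s b) %[mod a].
Proof.
move=> ab; rewrite /= modn_mod modn_dvdm//.
by rewrite -modnDm (residue_mod r ab) (residue_mod s ab) modnDm.
Qed.

Fact Zhat_mul_subproof (r s : Zhat) (a b : posnat) : (a %| b)%N ->
  Zp_mul (residue r a) (residue s a) =
  Zp_mul (residue r b) (residue s b) %[mod a].
Proof.
move=> ab; rewrite /= modn_mod modn_dvdm//.
by rewrite -modnMm (residue_mod r ab) (residue_mod s ab) modnMm.
Qed.

Definition Zhat_opp r := mk_Zhat (@Zhat_opp_subproof r).
Definition Zhat_add r s := mk_Zhat (@Zhat_add_subproof r s).
Definition Zhat_mul r s := mk_Zhat (@Zhat_mul_subproof r s).

Lemma residue_small (r : Zhat) (a : posnat) :
  (residue r a %% a)%N = residue r a.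
Proof. by rewrite modn_small. Qed.

Fact Zhat_addA : associative Zhat_add.
Proof.
by move=> r s t; apply: Zhat_ext => a; rewrite /= modnDml modnDmr addnA.
Qed.

Fact Zhat_addC : commutative Zhat_add.
Proof. by move=> r s; apply: Zhat_ext => a; rewrite /= addnC. Qed.

Fact Zhat_add0 : left_id (Zhat_nat 0) Zhat_add.
Proof.
by move=> r; apply: Zhat_ext => a; rewrite /= mod0n add0n residue_small.
Qed.

Fact Zhat_addN : left_inverse (Zhat_nat 0) Zhat_opp Zhat_add.
Proof.
move=> r; apply: Zhat_ext => a.
by rewrite /= modnDml subnK ?modnn ?mod0n// ltnW.
Qed.

HB.instance Definition _ := GRing.isZmodule.Build Zhat
  Zhat_addA Zhat_addC Zhat_add0 Zhat_addN.

Fact Zhat_mulA : associative Zhat_mul.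
Proof.
by move=> r s t; apply: Zhat_ext => a; rewrite /= modnMml modnMmr mulnA.
Qed.

Fact Zhat_mulC : commutative Zhat_mul.
Proof. by move=> r s; apply: Zhat_ext => a; rewrite /= mulnC. Qed.

Fact Zhat_mul1 : left_id (Zhat_nat 1) Zhat_mul.
Proof.
by move=> r; apply: Zhat_ext => a; rewrite /= modnMml mul1n residue_small.
Qed.

Fact Zhat_mulDl : left_distributive Zhat_mul Zhat_add.
Proof.
by move=> r s t; apply: Zhat_ext => a; rewrite /= modnMml modnDm mulnDl.
Qed.

Fact Zhat_one_neq0 : Zhat_nat 1 != 0.
Proof.
apply/eqP => /(congr1 (fun r => residue r (exist _ 2%N isT) : nat)).
by [].
Qed.

HB.instance Definition _ := GRing.Zmodule_isComNzRing.Build Zhat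
  Zhat_mulA Zhat_mulC Zhat_mul1 Zhat_mulDl Zhat_one_neq0.

(** * The map r |-> B(r, nabla) *)

(* [residue r a] is the representative in [0, a) of the class r(a), so this
   says that m belongs to r(a). *)
Definition Bset (r : Zhat) : set affN :=
  [set x : affN | let: (m, a) := x in m = residue r a %[mod a]].

Section B.
Variable r : Zhat.

Fact B_nonempty : Bset r !=set0.
Proof. by exists 1%g; rewrite /Bset/= !modn1. Qed.

Fact B_hereditary : hereditary (Bset r).
Proof.
move=> [m a] y /le_affNP[[k c] ->]; rewrite /Bset/= => E.
have ab : (a %| posnat_mul a c)%N by exact: dvdn_mulr.
have {}E : (m + a * k)%N =
    residue r (posnat_mul a c) %[mod posnat_mul a c] by exact: E.
have := congr1 (modn^~ a) E.
rewrite !(modn_dvdm _ ab) -(residue_mod r ab) => <-.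
by rewrite -modnDmr modnMr addn0.
Qed.

Fact B_directed : directed (Bset r).
Proof.
move=> [m a] [n b]; rewrite /Bset/= => Em En.
pose c := posnat_mul a b; pose k := (residue r c + (m + n) * c)%N.
have le_k (m' : nat) (a' : posnat) (d : posnat) : (a' * d = c)%N ->
    (m' <= m + n)%N -> m' = residue r a' %[mod a'] ->
    ((m', a') <= (k, c) :> affN)%O.
  move=> E m'le m'E; apply/le_affNP.
  have a'c : (a' %| c)%N by rewrite -E dvdn_mulr.
  have m'k : (m' <= k)%N.
    apply: (leq_trans m'le); apply: (leq_trans _ (leq_addl _ _)).
    by rewrite leq_pmulr// posnat_gt0.
  have dv : (a' %| k - m')%N.
    have kE : k = residue r c %[mod a'].
      by rewrite /k -modnDmr (eqP (dvdn_mull (m + n) a'c)) addn0.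
    by rewrite -eqn_mod_dvd// kE m'E (residue_mod r a'c).
  exists (((k - m') %/ a')%N, d); congr pair; last exact: posnat_inj.
  by rewrite /= mulnC divnK// subnKC.
exists (k, c); split.
- by rewrite /Bset/= /k addnC modnMDl.
- exact: (le_k m a b) (leq_addr _ _) Em.
- by apply: (le_k n b a) (leq_addl _ _) En; rewrite /= mulnC.
Qed.

Definition B : nica_spectrum := mk_nica B_nonempty B_hereditary B_directed.

Lemma carrier_B : carrier B = Bset r.
Proof. exact: carrier_mk_nica. Qed.

End B.

(** * Homeomorphisms onto a subspace *)

Definition homeomorphism_onto (T U : topologicalType) (f : T -> U)
    (A : set U) :=
  [/\ set_bij [set: T] A f, continuous f &
      exists g : U -> T, cancel f g /\ {within A, continuous g}].

(* Main.v *)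
(* An element w of the spectrum is some B r iff, for all n and a, it contains
   (n + i, a) for some i < a: for n = 0 this yields the residues r(a), and for
   arbitrary n it forces w to be all of B r.  The condition is closed, so the
   range of B is closed, and it passes to larger sets, so every B r is maximal.
   Conversely every w lies below some B r. *)

Require Import Defs.
From mathcomp Require Import all_boot all_order all_algebra.
From mathcomp Require Import all_classical all_reals all_analysis.

Local Open Scope classical_set_scope.
Local Open Scope ring_scope.

Import Order.TTheory GRing.Theory Num.Theory.

(** * Coordinatewise convergence in subspaces of products *)

Lemma cvg_subprod (I : eqType) (K : I -> topologicalType)
    (A : set (prod_topology K)) (F : set_system A) (w : A) :
  Filter F -> (forall i, (\val v i : K i) @[v --> F] --> (\val w i : K i)) ->
  F --> w.
Proof.
move=> FF Fw.
suff cvg_val : set_val @ F --> (set_val w : prod_topology K).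
  move=> U [_ [[C oC <-] Cw] CU]; apply: filterS CU _.
  by apply: cvg_val; exact: open_nbhs_nbhs.
apply/cvg_sup => i U [_ [[C oC <-] Cw] CU]; apply: filterS CU _.
by apply: (Fw i); exact: open_nbhs_nbhs.
Qed.

Lemma coord_continuous (I : eqType) (K : I -> topologicalType)
    (A : set (prod_topology K)) (i : I) :
  continuous (fun v : A => \val v i : K i).
Proof.
move=> w; apply: (@continuous_comp A (prod_topology K) (K i) set_val (proj i)).
  exact: initial_continuous.
exact: proj_continuous.
Qed.

Lemma near_carrier (x : affN) (w : nica_spectrum) :
  \forall v \near w, \val v x = \val w x.
Proof. exact: (@coord_continuous _ _ nica_set x w _ (discrete_set1 _)). Qed.

Lemma near_residue (a : posnat) (r : Zhat) :
  \forall s \near r, residue s a = residue r a.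
Proof.
exact: (@coord_continuous _ (fun a => discrete_topology (Zmod a))
  coherent a r _ (discrete_set1 _)).
Qed.

(** * Injectivity and continuity of [B] *)

Lemma val_carrierE (w : nica_spectrum) (x : affN) :
  \val w x = `[< carrier w x >].
Proof. by apply/idP/asboolP. Qed.

Lemma val_BE (r : Zhat) (m : nat) (a : posnat) :
  \val (B r) (m, a) = (m == residue r a %[mod a]).
Proof. by rewrite val_carrierE carrier_B; apply/asboolP/eqP. Qed.

(** The point (r(a), a) of B(r) recovers r(a): if it lies in B(s), then r(a) and s(a) are congruent
    mod a and both below a. *)
Lemma B_inj : injective B.
Proof.
move=> r s rs; apply: Zhat_ext => a.
have := val_BE r (residue r a) a; rewrite rs val_BE eqxx.
by rewrite !residue_small => /eqP.
Qed.

(** Coordinate (m, a) of B(r) depends on r(a) alone, which is locally constant in r. *)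
Lemma B_continuous : continuous B.
Proof.
move=> r; have FB : Filter (B @ r) by apply: fmap_filter; exact: nbhs_filter.
apply: (@cvg_subprod _ _ nica_set (B @ r) (B r) FB) => -[m a].
apply/(@discrete_cvg bool); by apply: filterS (near_residue a r) => s sr;
  have := val_BE s m a; rewrite sr -val_BE.
Qed.

(** * The order in terms of congruences *)

Lemma le_affN_mod (m n : nat) (a b : posnat) :
  ((m, a) <= (n, b) :> affN)%O -> n = m %[mod a].
Proof.
by move=> /le_affNP[[k c] [-> _]]; rewrite /= -modnDmr modnMr addn0.
Qed.

Lemma le_affN_residue (m n : nat) (a b : posnat) :
  (m <= n)%N -> n = m %[mod a] -> (a %| b)%N -> ((m, a) <= (n, b) :> affN)%O.
Proof.
move=> mn nm ab.
have c0 : (0 < b %/ a)%N.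
  by rewrite divn_gt0 ?posnat_gt0// dvdn_leq ?posnat_gt0.
apply/le_affNP; exists (((n - m) %/ a)%N, exist _ (b %/ a)%N c0); congr pair.
  by rewrite /= mulnC divnK ?subnKC// -eqn_mod_dvd//; apply/eqP.
by apply: posnat_inj; rewrite -[RHS]/(a * (b %/ a))%N mulnC divnK.
Qed.

Lemma carrier_hereditary (w : nica_spectrum) : hereditary (carrier w).
Proof. by have /set_mem[] := valP w. Qed.

Lemma carrier_directed (w : nica_spectrum) : directed (carrier w).
Proof. by have /set_mem[] := valP w. Qed.

(** A common upper bound (k, c) has k congruent to m mod a and to n mod b, hence also to n mod a. *)
Lemma carrier_congr (w : nica_spectrum) (m n : nat) (a b : posnat) :
  carrier w (m, a) -> carrier w (n, b) -> (a %| b)%N -> m = n %[mod a].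
Proof.
move=> wm wn ab; have [[k c] [_ mk nk]] := carrier_directed _ _ _ wm wn.
rewrite -(le_affN_mod _ _ _ _ mk).
have := congr1 (modn^~ a) (le_affN_mod _ _ _ _ nk).
by rewrite !modn_dvdm.
Qed.

(** * Recognising the sets B(r) *)

Definition meets_intervals (A : set affN) :=
  forall (n : nat) (a : posnat), exists i : 'I_a, A ((n + i)%N, a).

Lemma Bset_meets_intervals (r : Zhat) : meets_intervals (Bset r).
Proof.
(* The index must be r(a) - n mod a; the term n(a - 1) stands for -n in the naturals. *)
move=> n a; exists (Ordinal (ltn_pmod (residue r a + n * a.-1) (posnat_gt0 a))).
rewrite /Bset/= modnDmr addnCA -mulnS prednK ?posnat_gt0//.
by rewrite -modnDmr modnMl addn0.
Qed.

Lemma meets_intervals_B (w : nica_spectrum) :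
  meets_intervals (carrier w) -> exists r, B r = w.
Proof.
move=> wI; pose f a := projT1 (cid (wI 0%N a)).
have wf a : carrier w (f a : nat, a) by rewrite /f; case: cid.
have fP (a b : posnat) : (a %| b)%N -> f a = f b %[mod a].
  exact: carrier_congr.
exists (@mk_Zhat f fP); apply: carrier_inj; rewrite carrier_B.
apply/seteqP; split=> -[m a]; last first.
  by move=> wm; exact: carrier_congr wm (wf a) _.
(* In the interval starting at m, some (m + i, a) lies in [w]. Both m + i and m are congruent to
   [f a], so a divides i < a and i = 0. *)
rewrite /Bset/= => mE; have [i wi] := wI m a.
have : (m + i)%N = m %[mod a].
  by rewrite mE; exact: carrier_congr wi (wf a) _.
move/eqP; rewrite -[X in _ == X %[mod _]]addn0 eqn_modDl mod0n modn_small//.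
move=> /eqP i0.
by rewrite i0 addn0 in wi.
Qed.

(** * Maximal elements and the boundary *)

(** Otherwise the complement of every fibre of [f] is in [F], yet their finite intersection is
    empty. *)
Lemma ultra_fin (T : Type) (F : set_system T) (I : finType) (f : T -> I) :
  UltraFilter F -> exists i, F [set x | f x = i].
Proof.
move=> FU; apply: contrapT => /forallNP nF.
have : F [set x | forall i, f x <> i].
  apply: filter_forall => i.
  by have [/nF//|] := in_ultra_setVsetC [set x | f x = i] FU.
by move=> /filter_ex[x /(_ (f x))].
Qed.

(* The value r(a) is the limit of [m mod a] as [(m, b)] runs through [w] along
   an ultrafilter refining the directed order of [w]. *)
Lemma carrier_sub_B (w : nica_spectrum) : exists r, carrier w `<=` Bset r.
Proof.
pose up x := [set y | carrier w y /\ (x <= y)%O].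
have Fup : ProperFilter (filter_from (carrier w) up).
  apply: filter_from_proper; last by move=> x wx; exists x.
  apply: filter_from_filter; first by have /set_mem[] := valP w.
  move=> x y wx wy; have [z [wz xz yz]] := carrier_directed _ _ _ wx wy.
  exists z => // t [wt zt].
  by split; split=> //; [exact: le_trans zt|exact: le_trans zt].
have [G [GU FG]] := @ultraFilterLemma _ _ Fup.
have GF : Filter G by apply: filter_filter.
pose g a (x : affN) : Zmod a := Zmod_nat x.1 a.
have Gf a := cid (@ultra_fin _ G _ (g a) GU).
pose f a := projT1 (Gf a).
have fE a : G [set x | g a x = f a] by rewrite /f; case: (Gf a).
have fP (a b : posnat) : (a %| b)%N -> f a = f b %[mod a].
  move=> ab; have /filter_ex[x [/= <- <-]] := @filterI _ G GF _ _ (fE a) (fE b).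
  by rewrite /= modn_mod modn_dvdm.
exists (@mk_Zhat f fP) => -[m a] wm.
(* All points above (m, a) have first component congruent to m mod a, so the limit residue [f a] is
   m mod a. *)
have Gup : G (up (m, a)) by apply: FG; exists (m, a).
have /filter_ex[[n b] [/= gf [_ /le_affN_mod nm]]] :=
  @filterI _ G GF _ _ (fE a) Gup.
by rewrite /Bset/= -[residue _ a]/(f a) -gf/= modn_mod nm.
Qed.

Lemma meets_intervals_sub (A A' : set affN) :
  A `<=` A' -> meets_intervals A -> meets_intervals A'.
Proof. by move=> AA' AI n a; have [i /AA'] := AI n a; exists i. Qed.

Lemma Bset_sub (r s : Zhat) : Bset r `<=` Bset s -> r = s.
Proof.
move=> rs; apply: Zhat_ext => a.
have : Bset s (residue r a : nat, a) by exact: rs.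
by rewrite /Bset/= !residue_small.
Qed.

Lemma nica_maximalE : nica_maximal = range B.
Proof.
apply/seteqP; split=> [w wmax|_ [r _ <-] v].
  have [r wr] := carrier_sub_B w; exists r => //.
  by apply: wmax; rewrite carrier_B.
rewrite carrier_B => rv.
have [s sv] : exists s, B s = v.
  exact/meets_intervals_B/(meets_intervals_sub _ _ rv)/Bset_meets_intervals.
by move: rv; rewrite -sv carrier_B => /Bset_sub ->.
Qed.

Lemma nica_boundaryE : nica_boundary = range B.
Proof.
rewrite /nica_boundary nica_maximalE; apply/seteqP; split; last first.
  exact: subset_closure.
move=> w wcl; have [|r <-] := meets_intervals_B w; last by exists r.
(* Only the finitely many coordinates (n + i, a) with i < a are involved, so they are constant near
   [w]; a nearby B(r) supplies the index. *)
move=> n a; have nw : \forall v \near w,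
    forall i : 'I_a, \val v ((n + i)%N, a) = \val w ((n + i)%N, a).
  apply: (@filter_forall _ _ _ _ (nbhs_filter w)) => i; exact: near_carrier.
have [_ [[r _ <-] rw]] := wcl _ nw.
have [i ri] := Bset_meets_intervals r n a.
by exists i; rewrite /carrier /supp/= -rw val_BE; apply/eqP.
Qed.

(** * Continuity of the inverse *)

(** The default 0 is taken only outside the range of [B], that is, off the boundary. *)
Definition Binv (w : nica_spectrum) : Zhat := xget 0 [set r | B r = w].

Lemma BK : cancel B Binv.
Proof.
move=> r; apply: B_inj.
by apply: (@xgetPex _ (0 : Zhat) [set s | B s = B r]); exists r.
Qed.

Lemma Binv_continuous : {within nica_boundary, continuous Binv}.
Proof.
apply/subspace_continuousP => w; rewrite {1}nica_boundaryE => -[r _ <-].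
apply: (@cvg_subprod _ (fun a => discrete_topology (Zmod a)) coherent) => a.
apply/(@discrete_cvg (discrete_topology (Zmod a))).
(* One coordinate suffices: any B(s) containing (r(a), a) has s(a) = r(a). *)
have := near_carrier (residue r a : nat, a) (B r).
apply: filterS => v vr; rewrite {1}nica_boundaryE => -[s _ sv].
suff : residue (Binv v) a = residue (Binv (B r)) a by [].
move: vr; rewrite -sv !BK !val_BE eqxx !residue_small => /eqP rs.
exact/val_inj.
Qed.

(** * The action on residues *)

Lemma residue_natr (n : nat) (a : posnat) : residue n%:R a = (n %% a)%N :> nat.
Proof.
elim: n => [//|n IH]; rewrite -natr1 /= -[X in (X + _)%N]/(residue n%:R a : nat).
by rewrite IH modnDm addn1.
Qed.

Lemma residue_affine (m a : nat) (r : Zhat) (b : posnat) :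
  residue (m%:R + a%:R * r) b = ((m + a * residue r b) %% b)%N :> nat.
Proof.
rewrite -[LHS]/((residue m%:R b + (residue a%:R b * residue r b) %% b) %% b)%N.
by rewrite !residue_natr modnDm -modnDmr modnMml modnDmr.
Qed.

Lemma theta_B (m : nat) (a : posnat) (r : Zhat) :
  theta ((m, a) : affN) (B r) = B (m%:R + a%:R * r).
Proof.
apply: carrier_inj; rewrite carrier_theta carrier_B; apply/seteqP; split.
  move=> y [_ [[n b] + <-] yx]; rewrite carrier_B => nr.
  apply: B_hereditary yx _; move: nr.
  rewrite /Bset => nr.
  set c := posnat_mul a b.
  suff : (m + a * n)%N = residue (m%:R + a%:R * r) c %[mod c] by [].
  rewrite residue_affine modn_mod.
  (* Since n is congruent to r(b), hence to r(ab), mod b, an is congruent to a r(ab) mod ab. *)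
  apply/eqP; rewrite eqn_modDl -!muln_modr nr -(residue_mod r)//.
  exact: dvdn_mull.
move=> [n b] nb; have {nb} nr : n = (m + a * residue r b)%N %[mod b].
  by rewrite -[RHS]modn_mod -residue_affine.
(* As k is congruent to r(b) mod b, (k, b) lies in B(r); the term [n * b] ensures n <= m + ak, which
   the order requires. *)
pose k := (residue r b + n * b)%N.
exists (((m, a) : affN) * ((k, b) : affN))%g.
  exists ((k, b) : affN) => //.
  by rewrite carrier_B /Bset/= /k addnC modnMDl.
apply: le_affN_residue.
- rewrite /= /k mulnDr; apply: leq_trans (leq_addl _ _).
  apply: leq_trans (leq_addl _ _).
  by rewrite mulnCA leq_pmulr// muln_gt0 !posnat_gt0.
- by rewrite nr /= /k mulnDr addnA mulnCA mulnA -modnDmr modnMl addn0.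
- exact: dvdn_mull.
Qed.

Theorem proposition5p7 :
  homeomorphism_onto B nica_boundary /\
  (forall (m : nat) (a : posnat) (r : Zhat),
     theta ((m, a) : affN) (B r) = B (m%:R + a%:R * r)).
Proof.
split; last exact: theta_B.
split; last by exists Binv; split; [exact: BK|exact: Binv_continuous].
  rewrite nica_boundaryE; split; [by move=> r _; exists r| |by []].
  by move=> r s _ _; exact: B_inj.
exact: B_continuous.
Qed.
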